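(* Let $\Bbbk$ be a field of characteristic zero and let $M$ be a finite conformal module over the Weyl associative conformal algebra $U(2)$ (over $\Bbbk$). Then the reduced Hochschild cohomology satisfies $\mathrm{H}^k(U(2),M)=0$ for all $k\ge 2$.
   Context: $\Bbbk$ is a field of characteristic zero, $H=\Bbbk[\partial]$. A conformal algebra is an $H$-module $C$ with a $\Bbbk$-bilinear $\lambda$-product $(\cdot\,{}_{(\lambda)}\,\cdot):C\otimes C\to C[\lambda]$ such that $(\partial a\,{}_{(\lambda)}\,b)=-\lambda(a\,{}_{(\lambda)}\,b)$ and $(a\,{}_{(\lambda)}\,\partial b)=(\partial+\lambda)(a\,{}_{(\lambda)}\,b)$. It is associative if $a\,{}_{(\lambda)}\,(b\,{}_{(\mu)}\,c)=(a\,{}_{(\lambda)}\,b)\,{}_{(\lambda+\mu)}\,c$ for all $a,b,c\in C$. The Weyl conformal algebra $U(2)$ is the free $H$-module with basis $v,v^2,v^3,\dots$ (so $U(2)\simeq \Bbbk[\partial,v]v$) with $\lambda$-product determined by $(v^n\,{}_{(\lambda)}\,v^m)=v^n(v+\lambda)^m$ for $n,m\ge 1$; it is an associative conformal algebra. A conformal module over an associative conformal algebra $C$ is an $H$-module $M$ with a $\Bbbk$-bilinear $\lambda$-action $C\otimes M\to M[\lambda]$, $a\otimes m\mapsto a\,{}_{(\lambda)}\,m$, such that $(\partial a\,{}_{(\lambda)}\,m)=-\lambda(a\,{}_{(\lambda)}\,m)$, $(a\,{}_{(\lambda)}\,\partial m)=(\partial+\lambda)(a\,{}_{(\lambda)}\,m)$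 and $a\,{}_{(\lambda)}\,(b\,{}_{(\mu)}\,m)=(a\,{}_{(\lambda)}\,b)\,{}_{(\lambda+\mu)}\,m$. It is finite if it is finitely generated as an $H$-module. Hochschild cohomology (the right action on $M$ is taken to be zero): for $n\ge1$ the basic cochain space $\tilde{\mathrm C}^n(C,M)$ consists of all $\Bbbk$-linear maps $\varphi_{\bar\lambda}:C^{\otimes n}\to M[\bar\lambda]$, $\bar\lambda=(\lambda_1,\dots,\lambda_n)$, with $\varphi_{\bar\lambda}(a_1,\dots,\partial a_i,\dots,a_n)=-\lambda_i\varphi_{\bar\lambda}(a_1,\dots,a_n)$ for all $i$. The differential $d_n:\tilde{\mathrm C}^n(C,M)\to\tilde{\mathrm C}^{n+1}(C,M)$ is $$(d_n\varphi)_{\bar\lambda}(a_1,\dots,a_{n+1})=a_1\,{}_{(\lambda_1)}\,\varphi_{\bar\lambda_0}(a_2,\dots,a_{n+1})+\sum_{i=1}^n(-1)^i\varphi_{\bar\lambda_i}(a_1,\dots,a_i\,{}_{(\lambda_i)}\,a_{i+1},\dots,a_{n+1}),$$ where $\bar\lambda=(\lambda_1,\dots,\lambda_{n+1})$, $\bar\lambda_0=(\lambda_2,\dots,\lambda_{n+1})$, $\bar\lambda_i=(\lambda_1,\dots,\lambda_i+\lambda_{i+1},\dots,\lambda_{n+1})$. Each $\tilde{\mathrm C}^n(C,M)$ is a $\Bbbk[\partial]$-module via $(\partial\varphi)_{\bar\lambda}(a_1,\dots,a_n)=(\partial+\sum_{i=1}^n\lambda_i)\varphi_{\bar\lambda}(a_1,\dots,a_n)$,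 and $d_n$ commutes with $\partial$. The reduced Hochschild complex is $\mathrm C^\bullet(C,M)=\tilde{\mathrm C}^\bullet(C,M)/\partial\tilde{\mathrm C}^\bullet(C,M)$ with the induced differential; its cohomology is the reduced Hochschild cohomology $\mathrm H^\bullet(C,M)$. *)

(* Defs.v *)
From HB Require Import structures.
From mathcomp Require Import all_boot all_order all_algebra.
From mathcomp.multinomials Require Import -(notations) monalg.
From mathcomp.multinomials Require Import mpoly.
From mathcomp Require Import finmap.

Set Implicit Arguments.
Unset Strict Implicit.
Unset Printing Implicit Defensive.

Import GRing.Theory.
Local Open Scope ring_scope.

(* H = k[∂] is {poly k}, with ∂ = 'X.  An H-module is an lmodType {poly k};
   a scalar c : k acts on it as c%:P.  The map called ∂ below is therefore
   x |-> 'X *: x. *)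

(* [lpoly M n] is M[λ_1, ..., λ_n]: finitely supported families of elements of
   M indexed by multi-exponents.  The variable λ_(i+1) is 'X_i, i : 'I_n.
   Polynomials in the λ's with coefficients in H act on it through [lact]; in
   such a polynomial the constant 'X%:MP is ∂.  (monalg is not imported because
   its monomials and polynomials use the notations of mpoly.) *)
Notation lpoly M n := (monalg.malg 'X_{1..n} M).

Section LambdaPolynomials.
Variable k : fieldType.
Implicit Types M N : lmodType {poly k}.

Definition lconst M n (x : M) : lpoly M n := monalg.mkmalgU 0%MM x.

Definition lact M n (q : {mpoly {poly k}[n]}) (g : lpoly M n) : lpoly M n :=
  \sum_(al <- monalg.msupp g) \sum_(be <- msupp q)
    monalg.mkmalgU (al + be)%MM (q@_be *: monalg.mcoeff al g).

(* \sum_al x_al λ^al  |->  \sum_al f^al . (F x_al) : apply F to the coefficients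
   and put the polynomial f i in place of the i-th variable. *)
Definition lbind M N n m (f : 'I_n -> {mpoly {poly k}[m]})
    (F : M -> lpoly N m) (g : lpoly M n) : lpoly N m :=
  \sum_(al <- monalg.msupp g)
    lact (\prod_(i < n) f i ^+ al i) (F (monalg.mcoeff al g)).

Definition lsubst M n m (f : 'I_n -> {mpoly {poly k}[m]}) (g : lpoly M n) :
  lpoly M m := lbind f (@lconst M m) g.

End LambdaPolynomials.

Section Conformal.
Variables (k : fieldType) (C M : lmodType {poly k}).
Variables (prod : C -> C -> lpoly C 1) (act : C -> M -> lpoly M 1).

Definition lambda_bilinear : Prop :=
  [/\ forall (c : k) (a b : C) (x : M),
        act (c%:P *: a + b) x = lact c%:P%:MP (act a x) + act b x,
      forall (c : k) (a : C) (x y : M),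
        act a (c%:P *: x + y) = lact c%:P%:MP (act a x) + act a y,
      forall (a : C) (x : M), act ('X *: a) x = lact (- 'X_ord0) (act a x)
    & forall (a : C) (x : M),
        act a ('X *: x) = lact ('X%:MP + 'X_ord0) (act a x)].

(* a_(λ) (b_(μ) x) = (a_(λ) b)_(λ+μ) x in M[λ, μ], with λ = 'X_ord0 and
   μ = 'X_ord_max. *)
Definition lambda_associative : Prop :=
  forall (a b : C) (x : M),
    lbind (fun _ : 'I_1 => 'X_ord_max)
      (fun y => lsubst (fun _ : 'I_1 => 'X_ord0 : {mpoly {poly k}[2]}) (act a y))
      (act b x) =
    lbind (fun _ : 'I_1 => 'X_ord0)
      (fun c => lsubst
         (fun _ : 'I_1 => 'X_ord0 + 'X_ord_max : {mpoly {poly k}[2]}) (act c x))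
      (prod a b).

Definition conformal_module : Prop := lambda_bilinear /\ lambda_associative.

Definition finite_module : Prop :=
  exists (r : nat) (g : 'I_r -> M),
    forall x : M, exists c : 'I_r -> {poly k}, x = \sum_(i < r) c i *: g i.

Definition subst_arg n (a : {ffun 'I_n -> C}) (i : 'I_n) (x : C) :
  {ffun 'I_n -> C} := [ffun j => if j == i then x else a j].

Definition basic_cochain n (phi : {ffun 'I_n -> C} -> lpoly M n) : Prop :=
  (forall a i (c : k) (x y : C),
     phi (subst_arg a i (c%:P *: x + y)) =
     lact c%:P%:MP (phi (subst_arg a i x)) + phi (subst_arg a i y)) /\
  (forall a i (x : C),
     phi (subst_arg a i ('X *: x)) = lact (- 'X_i) (phi (subst_arg a i x))).

(* For i : 'I_n, the positions i and i+1 in 'I_n.+1; [skip i] enumerates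
   increasingly the positions other than i+1. *)
Definition pos0 n (i : 'I_n) : 'I_n.+1 := widen_ord (leqnSn n) i.
Definition pos1 n (i : 'I_n) : 'I_n.+1 := lift ord0 i.
Definition skip n (i j : 'I_n) : 'I_n.+1 := lift (pos1 i) j.

(* (a_1, ..., a_(n+1)) with the two arguments at positions i, i+1 replaced by
   the single argument c. *)
Definition merge_args n (a : {ffun 'I_n.+1 -> C}) (i : 'I_n) (c : C) :
  {ffun 'I_n -> C} := [ffun j => if j == i then c else a (skip i j)].

Definition merge_vars n (i j : 'I_n) : {mpoly {poly k}[n.+1]} :=
  if j == i then 'X_(pos0 i) + 'X_(pos1 i) else 'X_(skip i j).

(* In the i-th summand (i counted from 0) the product of the two merged
   arguments is a polynomial in λ_i with coefficients in C, to which phi is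
   extended coefficientwise. *)
Definition hochschild_d n (phi : {ffun 'I_n -> C} -> lpoly M n)
    (a : {ffun 'I_n.+1 -> C}) : lpoly M n.+1 :=
  lbind (fun j : 'I_n => 'X_(lift ord0 j))
    (fun x => lsubst (fun _ : 'I_1 => 'X_ord0 : {mpoly {poly k}[n.+1]})
                (act (a ord0) x))
    (phi [ffun j => a (lift ord0 j)])
  + \sum_(i < n)
      lbind (fun _ : 'I_1 => 'X_(pos0 i))
        (fun c => lsubst (merge_vars i) (phi (merge_args a i c)))
        (prod (a (pos0 i)) (a (pos1 i)))
      *~ (-1) ^+ i.+1.

Definition cochain_partial n (phi : {ffun 'I_n -> C} -> lpoly M n)
    (a : {ffun 'I_n -> C}) : lpoly M n :=
  lact ('X%:MP + \sum_(i < n) 'X_i) (phi a).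

(* Equality of the classes of phi and psi in the reduced complex, i.e. modulo
   the image of ∂ on basic cochains. *)
Definition reduced_eq n (phi psi : {ffun 'I_n -> C} -> lpoly M n) : Prop :=
  exists2 chi, basic_cochain chi &
    forall a, phi a - psi a = cochain_partial chi a.

Definition reduced_cocycle n (phi : {ffun 'I_n -> C} -> lpoly M n) : Prop :=
  basic_cochain phi /\ reduced_eq (hochschild_d phi) (fun=> 0).

Definition reduced_coboundary n :
    ({ffun 'I_n -> C} -> lpoly M n) -> Prop :=
  match n with
  | 0 => fun phi => reduced_eq phi (fun=> 0)
  | m.+1 => fun phi =>
      exists2 psi, basic_cochain psi & reduced_eq phi (hochschild_d psi)
  end.

(* The quotient of the reduced cocycles of degree n by the reduced
   coboundaries is zero. *)
Definition reduced_cohomology_eq0 n : Prop :=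
  forall phi : {ffun 'I_n -> C} -> lpoly M n,
    reduced_cocycle phi -> reduced_coboundary phi.

End Conformal.

(* U(2) = k[∂, v] v: the polynomial f : {poly {poly k}} in v stands for f v, so
   that the H-basis v, v^2, v^3, ... is 1, 'X, 'X^2, ... *)
Definition weyl (k : fieldType) : lmodType {poly k} := {poly {poly k}}.

Section Weyl.
Variable k : fieldType.

Definition weyl_v (n : nat) : weyl k := ('X^(n.-1) : {poly {poly k}}).

(* v^n (v + λ)^m expanded by the binomial formula, for n, m >= 1. *)
Definition weyl_basis_prod (n m : nat) : lpoly (weyl k) 1 :=
  \sum_(s < m.+1)
    lact ('X_ord0 ^+ s *+ 'C(m, s)) (lconst 1 (weyl_v (n + (m - s)))).

Definition subst_partial n (p : {poly k}) (y : {mpoly {poly k}[n]}) :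
  {mpoly {poly k}[n]} := (map_poly (fun c : k => c%:P%:MP) p).[y].

(* The sesquilinear extension:
   (p(∂) v^n)_(λ) (q(∂) v^m) = p(-λ) q(∂+λ) (v^n_(λ) v^m). *)
Definition weyl_prod (a b : weyl k) : lpoly (weyl k) 1 :=
  \sum_(i < size (a : {poly {poly k}})) \sum_(j < size (b : {poly {poly k}}))
    lact (subst_partial (a : {poly {poly k}})`_i (- 'X_ord0) *
          subst_partial (b : {poly {poly k}})`_j ('X%:MP + 'X_ord0))
      (weyl_basis_prod i.+1 j.+1).

End Weyl.

(* Main.v *)
(* The coefficients of the λ-products of U(2) span the right ideal pW of the Weyl
   algebra W, where [t, p] = 1; cohomology with zero right action is Ext over
   R = k + pW.  As 1 = t p - p t lies in WpW, the map a |-> (a t, - a) from pW to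
   R^2 followed by (r, s) |-> r p + s p t is the identity, so pW is a projective
   left R-module and Ext vanishes in degrees at least 2.  In terms of cochains this
   gives the homotopy
     (h phi)(a_1, ..., a_(n-1)) =
       [ (d/dλ_(n-1) - d/dλ_n) phi(a_1, ..., a_(n-1), v)
         + phi(a_1, ..., D a_(n-1), v) ]_(λ_n = 0),
   where D = d/d∂ on k[∂,v]v makes h phi sesquilinear in a_(n-1).  It satisfies
   h d - d h = (-1)^n, and it commutes with ∂ because d/dλ_(n-1) - d/dλ_n kills
   ∂ + λ_1 + ... + λ_n; so it also contracts the reduced complex. *)
From HB Require Import structures.
Require Import Defs.
From mathcomp Require Import all_boot all_order all_algebra finmap.
From mathcomp.multinomials Require Import -(notations) monalg.
From mathcomp.multinomials Require Import mpoly.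

Set Implicit Arguments.
Unset Strict Implicit.
Unset Printing Implicit Defensive.

Import GRing.Theory.
Local Open Scope ring_scope.

(** * Polynomials in λ *)

Section AdditiveMaps.
Variables (U V : zmodType) (F : U -> V).
Hypothesis FD : {morph F : x y / x + y}.

Lemma morphD0 : F 0 = 0.
Proof. by apply: (addrI (F 0)); rewrite -FD !addr0. Qed.

Let F_add : {additive U -> V} :=
  HB.pack F (GRing.isNmodMorphism.Build U V F (conj morphD0 FD)).

Lemma morphDN : {morph F : x / - x}.
Proof. exact: (raddfN F_add). Qed.

Lemma morphDMz z : {morph F : x / x *~ z}.
Proof. exact: (raddfMz F_add). Qed.

Lemma morphD_sum I (r : seq I) (P : pred I) (h : I -> U) :
  F (\sum_(i <- r | P i) h i) = \sum_(i <- r | P i) F (h i).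
Proof. exact: (raddf_sum F_add). Qed.
End AdditiveMaps.

(** * Sums over the support of a finitely supported family *)

Section MonalgSums.
Variables (K : choiceType) (U V : zmodType) (h : K -> U -> V).
Hypothesis hD : forall a, {morph h a : x y / x + y}.
Let lin (g : monalg.malg K U) :=
  \sum_(a <- monalg.msupp g) h a (monalg.mcoeff a g).

(** Points outside the support contribute [h a 0 = 0]. Two families can thus be summed over one
    common index set, which is what additivity in [g] requires. *)
Lemma malg_sumE (d : {fset K}) (g : monalg.malg K U) :
    (monalg.msupp g `<=` d)%fset ->
  lin g = \sum_(a <- d) h a (monalg.mcoeff a g).
Proof.
move=> sub; apply: big_fset_incl => // a _ /mcoeff_outdom ->.
exact: morphD0.
Qed.

Lemma malg_sumD : {morph lin : g1 g2 / g1 + g2}.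
Proof.
move=> g1 g2; pose d := (monalg.msupp g1 `|` monalg.msupp g2)%fset.
rewrite !(malg_sumE (d := d)) ?fsubsetUl ?fsubsetUr ?monalg.msuppD_le //.
by rewrite -big_split; apply: eq_bigr => a _; rewrite monalg.mcoeffD hD.
Qed.

Lemma malg_sumU a x : lin (monalg.mkmalgU a x) = h a x.
Proof.
by rewrite (malg_sumE (d := [fset a]%fset)) ?monalg.msuppU_le // big_seq_fset1 mcoeffUU.
Qed.
End MonalgSums.

(* mact, mbind and lmono are lact, lbind and mkmalgU, locked because unification
   otherwise unfolds the sums that define them. *)
HB.lock Definition mact (k : fieldType) (M : lmodType {poly k}) n q (g : lpoly M n) :=
  lact q g.

HB.lock Definition mbind (k : fieldType) (M N : lmodType {poly k}) n m
  (f : 'I_n -> {mpoly {poly k}[m]}) (F : M -> lpoly N m) g := lbind f F g.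

HB.lock Definition lmono (k : fieldType) (M : lmodType {poly k}) n
  (al : 'X_{1..n}) (x : M) : lpoly M n := @monalg.mkmalgU _ M al x.

Notation lcst n := (@lmono _ _ n 0%MM).

Section LambdaPolynomialTheory.
Variable k : fieldType.
Implicit Types M N : lmodType {poly k}.

Lemma lmonoD M n al : {morph @lmono k M n al : x y / x + y}.
Proof. by rewrite lmono.unlock; apply: monalgUD. Qed.

Lemma lmonoD0 M n al : @lmono k M n al 0 = 0.
Proof. exact: morphD0 (lmonoD al). Qed.

Lemma lmono_ind M n (P : lpoly M n -> Prop) :
    (forall al x, P (lmono al x)) ->
    (forall g1 g2, P g1 -> P g2 -> P (g1 + g2)) ->
  forall g, P g.
Proof.
move=> PU PD g; rewrite [g]monalgE; apply: (big_ind P) => [|//|al _].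
  (* The zero family is the monomial with coefficient 0, so the induction principle has no separate
     base case for it. *)
  by rewrite -(lmonoD0 M 0%MM).
by have := PU al (monalg.mcoeff al g); rewrite lmono.unlock.
Qed.

Lemma mactE M n q (g : lpoly M n) : mact q g = lact q g.
Proof. by rewrite mact.unlock. Qed.

Lemma mbindE M N n m (f : 'I_n -> {mpoly {poly k}[m]}) (F : M -> lpoly N m) g :
  mbind f F g = lbind f F g.
Proof. by rewrite mbind.unlock. Qed.

Lemma mcoeff_lmono M n (al be : 'X_{1..n}) (x : M) :
  monalg.mcoeff be (lmono al x) = if al == be then x else 0.
Proof. by rewrite lmono.unlock monalg.mcoeffU; case: eqP. Qed.

Section Action.
Variables (M : lmodType {poly k}) (n : nat).
Implicit Types (q : {mpoly {poly k}[n]}) (g : lpoly M n).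

Let term q al (x : M) : lpoly M n :=
  \sum_(be <- msupp q) lmono (al + be)%MM (q@_be *: x).

Let termD q al : {morph term q al : x y / x + y}.
Proof.
move=> x y; rewrite -big_split; apply: eq_bigr => be _.
by rewrite scalerDr lmonoD.
Qed.

Lemma mactDr q : {morph @mact k M n q : g1 g2 / g1 + g2}.
Proof.
move=> g1 g2; rewrite mact.unlock /lact; have := malg_sumD (termD q) g1 g2.
by rewrite /term lmono.unlock.
Qed.

Let mactU q al x : mact q (lmono al x) = term q al x.
Proof.
rewrite mact.unlock lmono.unlock; have := malg_sumU (termD q) al x.
by rewrite /term lmono.unlock.
Qed.

(** Adding [al] to exponents is injective, so each coefficient of the result sees at most one
    coefficient of [q]. The right-hand side no longer mentions the support of [q], and so is visibly
    additive in [q]. *)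
Let mcoeff_lactU q al (x : M) be : monalg.mcoeff be (mact q (lmono al x)) =
  if (al <= be)%MM then q@_(be - al) *: x else 0.
Proof.
rewrite mactU /term raddf_sum /=; case: ifP => le_al.
  case: (boolP ((be - al)%MM \in msupp q)) => [be_in | be_notin].
    rewrite (big_rem _ be_in) /= [(al + _)%MM]addmC submK //.
    rewrite [X in X + _]mcoeff_lmono eqxx.
    rewrite big1_seq; first exact: addr0.
    move=> ga /andP[_]; rewrite mem_rem_uniq ?msupp_uniq // inE => /andP[neq _].
    rewrite mcoeff_lmono; case: eqP => // eq_be; case/eqP: neq.
    by rewrite -eq_be addmC addmK.
  rewrite big1_seq ?memN_msupp_eq0 ?scale0r // => ga /andP[_ ga_in].
  rewrite mcoeff_lmono; case: eqP => // eq_be; case/negP: be_notin.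
  by rewrite -eq_be addmC addmK.
rewrite big1 // => ga _; rewrite mcoeff_lmono; case: eqP => // eq_be.
by rewrite -eq_be lem_addr in le_al.
Qed.

Lemma mactDl g : {morph (@mact k M n)^~ g : p q / p + q}.
Proof.
move=> p q; elim/lmono_ind: g => [al x|g1 g2 IH1 IH2]; last first.
  by rewrite 3!mactDr IH1 IH2; apply: addrACA.
apply/malgP => be; rewrite monalg.mcoeffD !mcoeff_lactU.
by case: ifP; rewrite ?addr0 // mcoeffD scalerDl.
Qed.

Lemma mact0r q : @mact k M n q 0 = 0.
Proof. exact: (morphD0 (mactDr q)). Qed.

Lemma mact0l g : mact 0 g = 0.
Proof. exact: (morphD0 (mactDl g)). Qed.

Lemma mactNl q g : mact (- q) g = - mact q g.
Proof. exact: (morphDN (mactDl g)). Qed.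

Lemma mact_monomU c (be al : 'X_{1..n}) (x : M) :
  mact (c *: 'X_[be]) (lmono al x) = lmono (al + be)%MM (c *: x).
Proof.
apply/malgP => ga; rewrite mcoeff_lactU mcoeff_lmono mcoeffZ mcoeffX.
case: ((al + be)%MM =P ga) => [<-|neq]; first by rewrite lem_addr addmC addmK eqxx mulr1.
case: ifP => // le_al; case: eqP => [eq_be|_]; last by rewrite mulr0 scale0r.
by case: neq; rewrite eq_be addmC submK.
Qed.

(** Additivity in all three arguments reduces this to monomials, where exponents add and
    coefficients multiply. *)
Lemma mactA p q g : mact (p * q) g = mact p (mact q g).
Proof.
elim/lmono_ind: g => [al x|g1 g2 IH1 IH2]; last by rewrite !mactDr IH1 IH2.
elim/mpolyind: p q => [|c be p _ _ IHp] q; first by rewrite mul0r !mact0l.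
rewrite mulrDl !mactDl IHp; congr (_ + _).
elim/mpolyind: q => [|d ga q _ _ IHq]; first by rewrite mulr0 !mact0l mact0r.
rewrite mulrDr !mactDl mactDr IHq; congr (_ + _).
rewrite -scalerAl -scalerAr scalerA -mpolyXD !mact_monomU scalerA.
by rewrite -addmA [(ga + be)%MM]addmC.
Qed.

Lemma mactC p q g : mact p (mact q g) = mact q (mact p g).
Proof. by rewrite -!mactA mulrC. Qed.

Lemma mact_const c (x : M) : mact c%:MP (lcst n x) = lcst n (c *: x).
Proof.
by rewrite -[c%:MP]mulr1 -mpolyX0 mul_mpolyC mact_monomU addm0.
Qed.

Lemma mact1 g : mact 1 g = g.
Proof.
elim/lmono_ind: g => [al x|g1 g2 IH1 IH2]; last by rewrite mactDr IH1 IH2.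
by rewrite -[X in mact X _]scale1r -mpolyX0 mact_monomU addm0 scale1r.
Qed.

Lemma mactX_U (be al : 'X_{1..n}) (x : M) :
  mact 'X_[be] (lmono al x) = lmono (al + be)%MM x.
Proof. by rewrite -[X in mact X _]scale1r mact_monomU scale1r. Qed.

Lemma mactX_const (al : 'X_{1..n}) (x : M) :
  mact 'X_[al] (lcst n x) = lmono al x.
Proof. by rewrite mactX_U add0m. Qed.

(** Most identities between additive maps on M[λ] below are proved by this induction: it suffices to
    compare constants and the effect of one variable. *)
Lemma lpoly_ind (P : lpoly M n -> Prop) :
    (forall x, P (lcst n x)) -> (forall i g, P g -> P (mact 'X_i g)) ->
    (forall g1 g2, P g1 -> P g2 -> P (g1 + g2)) ->
  forall g, P g.
Proof.
move=> P0 PX PD; elim/lmono_ind => [al x|]; last exact: PD.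
rewrite -mactX_const mpolyXE_id.
elim/big_rec: _ => [|i q _ IH]; first by rewrite mact1.
rewrite mactA; elim: (al i) => [|d IHd]; first by rewrite expr0 mact1.
by rewrite exprS mactA; apply: PX.
Qed.

End Action.

Section Bind.
Variables (M N : lmodType {poly k}) (n m : nat).
Variables (f : 'I_n -> {mpoly {poly k}[m]}) (F : M -> lpoly N m).
Hypothesis FD : {morph F : x y / x + y}.

Let term (al : 'X_{1..n}) (x : M) : lpoly N m := lact (\prod_(i < n) f i ^+ al i) (F x).

Let termD al : {morph term al : x y / x + y}.
Proof. by move=> x y; rewrite /term -!mactE FD mactDr. Qed.

Lemma mbindD : {morph mbind f F : g1 g2 / g1 + g2}.
Proof. by move=> g1 g2; rewrite mbind.unlock; apply: (malg_sumD termD). Qed.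

Lemma mbindU al x : mbind f F (lmono al x ) =
  mact (\prod_(i < n) f i ^+ al i) (F x).
Proof. by rewrite mbind.unlock lmono.unlock mactE; apply: (malg_sumU termD). Qed.

Lemma mbind_const x : mbind f F (lcst n x) = F x.
Proof.
by rewrite mbindU big1 ?mact1 // => i _; rewrite mnm0E expr0.
Qed.

(** Together with [mbindD] and [mbind_const] this characterises [mbind f F] as the additive
    extension of [F] that turns the i-th variable into [f i]. *)
Lemma mbindX i g : mbind f F (mact 'X_i g) = mact (f i) (mbind f F g).
Proof.
elim/lmono_ind: g => [al x|g1 g2 IH1 IH2]; last by rewrite mactDr !mbindD mactDr IH1 IH2.
rewrite mactX_U !mbindU -[RHS]mactA; congr (mact _ _).
(* The product of powers is, by definition, the evaluation [mmap1] of a monomial, which is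
   multiplicative in the exponent. *)
have mmap1E (be : 'X_{1..n}) : \prod_(j < n) f j ^+ be j = mmap1 f be by [].
rewrite !mmap1E commr_mmap1_M; first by rewrite mmap1U mulrC.
by move=> *; apply: mulrC.
Qed.

End Bind.

Lemma eq_mbind M N n m (f f' : 'I_n -> {mpoly {poly k}[m]}) (F F' : M -> lpoly N m) :
  f =1 f' -> F =1 F' -> mbind f F =1 mbind f' F'.
Proof.
move=> eq_f eq_F g; rewrite !mbindE; apply: eq_bigr => al _; rewrite eq_F.
by rewrite (eq_bigr (fun i => f' i ^+ al i)) // => i _; rewrite eq_f.
Qed.

End LambdaPolynomialTheory.


Notation msubst f := (mbind f (lcst _)).

(** * Derivations *)

(** The partial derivative in the i-th variable. The subtraction of exponents is truncated, which is
    harmless: where it truncates, the coefficient is multiplied by 0. *)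
HB.lock Definition lderiv (k : fieldType) (M : lmodType {poly k}) n (i : 'I_n)
    (g : lpoly M n) : lpoly M n :=
  \sum_(al <- monalg.msupp g) lmono (al - U_(i))%MM (monalg.mcoeff al g *+ al i).

(** The derivation along the substitution [f] in the direction [c]: the derivative at ε = 0 of the
    substitution of [f i] + ε [c i] for the i-th variable. *)
HB.lock Definition mtwist (k : fieldType) (M : lmodType {poly k}) n m
    (f c : 'I_n -> {mpoly {poly k}[m]}) (g : lpoly M n) : lpoly M m :=
  \sum_(i < n) mact (c i) (msubst f (lderiv i g)).

Section Derivations.
Variable k : fieldType.
Implicit Types M N : lmodType {poly k}.

Lemma lderivD M n (i : 'I_n) : {morph @lderiv k M n i : g1 g2 / g1 + g2}.
Proof.
pose term (al : 'X_{1..n}) (x : M) := lmono (al - U_(i))%MM (x *+ al i).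
have termD al : {morph term al : x y / x + y}.
  by move=> x y; rewrite /term mulrnDl lmonoD.
by move=> g1 g2; rewrite lderiv.unlock; apply: (malg_sumD termD).
Qed.

Lemma lderiv_mono M n (i : 'I_n) al (x : M) :
  lderiv i (lmono al x) = lmono (al - U_(i))%MM (x *+ al i).
Proof.
pose term (al : 'X_{1..n}) (x : M) := lmono (al - U_(i))%MM (x *+ al i).
have termD be : {morph term be : y z / y + z}.
  by move=> y z; rewrite /term mulrnDl lmonoD.
rewrite lderiv.unlock; have := malg_sumU termD al x.
by rewrite /term lmono.unlock.
Qed.

Lemma lderiv_const M n (i : 'I_n) (x : M) : lderiv i (lcst n x) = 0.
Proof. by rewrite lderiv_mono mnm0E mulr0n lmonoD0. Qed.

Lemma lderivX M n (i j : 'I_n) (g : lpoly M n) :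
  lderiv i (mact 'X_j g) = mact 'X_j (lderiv i g) + (if i == j then g else 0).
Proof.
elim/lmono_ind: g => [al x|g1 g2 IH1 IH2]; last first.
  rewrite !(mactDr, lderivD) IH1 IH2.
  by case: ifP => _; [apply: addrACA | rewrite !addr0].
rewrite mactX_U !lderiv_mono mactX_U mnmDE mnm1E (eq_sym j i).
case: eqP => [<-{j}|neq]; last first.
  rewrite addn0 addr0; have [al0|al_gt0] := posnP (al i).
    by rewrite al0 !mulr0n !lmonoD0.
  congr lmono; apply/mnmP => l; rewrite !(mnmDE, mnmBE, mnm1E).
  case: (i =P l) => [<-|_]; last by rewrite !subn0.
  by case: (j =P i) => [eq_ji|_]; [case: neq | rewrite !addn0].
(* If [al i] is 0, subtracting and adding back [U_(i)] does not return [al], but the coefficient in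
   front is then 0. *)
rewrite addmK addn1; have [al0|al_gt0] := posnP (al i).
  by rewrite al0 !mulr0n lmonoD0 add0r mulr1n.
rewrite submK; last by apply/mnm_lepP => l; rewrite mnm1E; case: eqP => // <-.
by rewrite mulrSr lmonoD.
Qed.

Section Twist.
Variables (M : lmodType {poly k}) (n m : nat).
Variables f c : 'I_n -> {mpoly {poly k}[m]}.
Implicit Types g : lpoly M n.

Lemma msubstD : {morph (msubst f : lpoly M n -> lpoly M m) : g1 g2 / g1 + g2}.
Proof. exact/mbindD/lmonoD. Qed.

Lemma msubstX i g : msubst f (mact 'X_i g) = mact (f i) (msubst f g).
Proof. exact/mbindX/lmonoD. Qed.

Lemma msubst_const x : msubst f (lcst n x) = lcst m x :> lpoly M m.
Proof. exact/mbind_const/lmonoD. Qed.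

Lemma mtwistD : {morph @mtwist k M n m f c : g1 g2 / g1 + g2}.
Proof.
move=> g1 g2; rewrite mtwist.unlock -big_split; apply: eq_bigr => i _.
by rewrite lderivD msubstD mactDr.
Qed.

Lemma mtwist_const x : mtwist f c (lcst n x) = 0 :> lpoly M m.
Proof.
rewrite mtwist.unlock big1 // => i _.
by rewrite lderiv_const (morphD0 msubstD) mact0r.
Qed.

(** The Leibniz rule along [f]; with [mtwistD] and [mtwist_const] it replaces the definition from
    here on. *)
Lemma mtwistX i g :
  mtwist f c (mact 'X_i g) = mact (f i) (mtwist f c g) + mact (c i) (msubst f g).
Proof.
rewrite mtwist.unlock (morphD_sum (mactDr _)) [X in _ + X](_ : _ =
  \sum_(j < n) (if j == i then mact (c i) (msubst f g) else 0)); last first.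
  by rewrite -big_mkcond big_pred1_eq.
rewrite -big_split; apply: eq_bigr => j _; rewrite lderivX msubstD msubstX mactDr.
rewrite mactC; case: eqP => [->//|_].
by rewrite (morphD0 msubstD) mact0r.
Qed.

Lemma msubst_coef a g : msubst f (mact a%:MP g) = mact a%:MP (msubst f g).
Proof.
elim/lpoly_ind: g => [x|i g IH|g1 g2 IH1 IH2].
- by rewrite mact_const !msubst_const mact_const.
- by rewrite mactC !msubstX IH mactC.
- by rewrite mactDr !msubstD mactDr IH1 IH2.
Qed.

Lemma mtwist_coef a g : mtwist f c (mact a%:MP g) = mact a%:MP (mtwist f c g).
Proof.
elim/lpoly_ind: g => [x|i g IH|g1 g2 IH1 IH2].
- by rewrite mact_const !mtwist_const mact0r.
- rewrite mactC !mtwistX IH mactDr msubst_coef.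
  by congr (_ + _); apply: mactC.
- by rewrite mactDr !mtwistD mactDr IH1 IH2.
Qed.

End Twist.

(** A map that intertwines the variables passes under the extension and acts on the coefficients.
    This is how evaluations and derivations are moved through the λ-products in the differential. *)
Lemma morph_mbind M N N' n m p (f : 'I_n -> {mpoly {poly k}[m]})
    (f' : 'I_n -> {mpoly {poly k}[p]}) (F : M -> lpoly N m)
    (Phi : lpoly N m -> lpoly N' p) (g : lpoly M n) :
    {morph F : x y / x + y} -> {morph Phi : x y / x + y} ->
    (forall i y, Phi (mact (f i) y) = mact (f' i) (Phi y)) ->
  Phi (mbind f F g) = mbind f' (Phi \o F) g.
Proof.
move=> FD PhiD PhiX.
have PFD : {morph Phi \o F : x y / x + y} by move=> x y /=; rewrite FD PhiD.
elim/lpoly_ind: g => [x|i g IH|g1 g2 IH1 IH2].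
- by rewrite !mbind_const.
- by rewrite !mbindX // PhiX IH.
- by rewrite !mbindD // PhiD IH1 IH2.
Qed.

Lemma mbind_addF M N n m (f : 'I_n -> {mpoly {poly k}[m]})
    (F G : M -> lpoly N m) (g : lpoly M n) :
    {morph F : x y / x + y} -> {morph G : x y / x + y} ->
  mbind f (fun x => F x + G x) g = mbind f F g + mbind f G g.
Proof.
move=> FD GD; have FGD : {morph (fun x => F x + G x) : x y / x + y}.
  by move=> x y /=; rewrite FD GD; apply: addrACA.
elim/lpoly_ind: g => [x|i g IH|g1 g2 IH1 IH2].
- by rewrite !mbind_const.
- by rewrite !mbindX // IH mactDr.
- by rewrite !mbindD // IH1 IH2; apply: addrACA.
Qed.

End Derivations.


(** * The Weyl conformal algebra *)

(* The derivation d/d∂ of U(2) = k[∂,v]v. *)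
Definition weyl_deriv (k : fieldType) (a : weyl k) : weyl k :=
  map_poly (@deriv k) (a : {poly {poly k}}).

Section WeylTheory.
Variable k : fieldType.
Implicit Types a b : weyl k.

(** [subst_partial] maps a bare function over the coefficients, so additivity is checked coefficient
    by coefficient. *)
Lemma subst_partialD n (y : {mpoly {poly k}[n]}) :
  {morph (fun p => subst_partial p y) : p q / p + q}.
Proof.
move=> p q; rewrite /subst_partial -hornerD; congr (_.[_]).
apply/polyP => i; rewrite coefD !coef_map_id0 ?polyC0 ?mpolyC0 //.
by rewrite coefD polyCD mpolyCD.
Qed.

Lemma subst_partialX n (y : {mpoly {poly k}[n]}) p :
  subst_partial ('X * p) y = y * subst_partial p y.
Proof.
rewrite /subst_partial mulrC [RHS]mulrC -hornerMX; congr (_.[_]).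
apply/polyP => i; rewrite coefMX !coef_map_id0 ?polyC0 ?mpolyC0 // coefMX.
by case: (i == 0)%N; rewrite ?polyC0 ?mpolyC0.
Qed.

Lemma subst_partialC n (y : {mpoly {poly k}[n]}) (c : k) :
  subst_partial c%:P y = c%:P%:MP.
Proof.
rewrite /subst_partial -[RHS](hornerC _ y); congr (_.[_]).
apply/polyP => i; rewrite coef_map_id0 ?polyC0 ?mpolyC0 // !coefC.
by case: ifP; rewrite ?polyC0 ?mpolyC0.
Qed.

(** Reduces identities that respect sums and multiplication by ∂ to scalar multiples of the basis v,
    v^2, and so on. *)
Lemma weyl_ind (P : weyl k -> Prop) :
    (forall (c : k) j, P (c%:P *: ('X^j : {poly {poly k}}))) ->
    (forall a, P a -> P ('X *: a)) ->
    (forall a b, P a -> P b -> P (a + b)) ->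
  forall a, P a.
Proof.
move=> PC PX PD a.
have P0 : P 0 by have := PC 0 0; rewrite polyC0 scale0r.
rewrite -[a](coefK (a : {poly {poly k}})) poly_def.
apply: (big_ind P) => // j _; elim/poly_ind: (_`_j) => [|p c IH].
  by rewrite scale0r.
rewrite scalerDl; apply: PD; last exact: PC.
by rewrite mulrC -scalerA; apply: PX.
Qed.

Lemma weyl_derivD : {morph @weyl_deriv k : a b / a + b}.
Proof.
move=> a b; apply/polyP => i; rewrite coefD !coef_map_id0 ?deriv0 //.
by rewrite coefD derivD.
Qed.

Lemma weyl_derivX a : weyl_deriv ('X *: a) = a + 'X *: weyl_deriv a.
Proof.
apply/polyP => i; rewrite coefD coefZ !coef_map_id0 ?deriv0 // coefZ.
by rewrite derivM derivX mul1r.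
Qed.

Lemma weyl_derivZ (c : k) a : weyl_deriv (c%:P *: a) = c%:P *: weyl_deriv a.
Proof.
apply/polyP => i; rewrite coefZ !coef_map_id0 ?deriv0 // coefZ.
by rewrite derivM derivC mul0r add0r.
Qed.

Lemma weyl_derivXn j : weyl_deriv ('X^j : {poly {poly k}}) = 0.
Proof.
apply/polyP => i; rewrite coef0 coef_map_id0 ?deriv0 // coefXn.
by case: (i == j); rewrite ?derivC ?deriv0.
Qed.

Let prod_term a b i j : lpoly (weyl k) 1 :=
  mact (subst_partial (a : {poly {poly k}})`_i (- 'X_ord0) *
        subst_partial (b : {poly {poly k}})`_j ('X%:MP + 'X_ord0))
    (weyl_basis_prod k i.+1 j.+1).

Let prod_term0l a b i j : (a : {poly {poly k}})`_i = 0 -> prod_term a b i j = 0.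
Proof.
by rewrite /prod_term => ->; rewrite (morphD0 (subst_partialD _)) mul0r mact0l.
Qed.

Let prod_term0r a b i j : (b : {poly {poly k}})`_j = 0 -> prod_term a b i j = 0.
Proof.
by rewrite /prod_term => ->; rewrite (morphD0 (subst_partialD _)) mulr0 mact0l.
Qed.

(** Coefficients beyond the size vanish, so the summation bounds may be enlarged; sums of arguments
    can then be treated with common bounds. *)
Let weyl_prodE n m a b :
    (size (a : {poly {poly k}}) <= n)%N -> (size (b : {poly {poly k}}) <= m)%N ->
  weyl_prod a b = \sum_(i < n) \sum_(j < m) prod_term a b i j.
Proof.
move=> le_a le_b.
have -> : weyl_prod a b =
    \sum_(i < size (a : {poly {poly k}})) \sum_(j < size (b : {poly {poly k}}))
      prod_term a b i j by rewrite /prod_term mact.unlock.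
rewrite (big_ord_widen _ (fun i => \sum_(j < _) prod_term a b i j) le_a) big_mkcond.
apply: eq_bigr => i _; case: ltnP => [_|ge_i]; last first.
  by rewrite big1 // => j _; rewrite prod_term0l // nth_default.
rewrite (big_ord_widen _ (fun j => prod_term a b i j) le_b) big_mkcond.
apply: eq_bigr => j _; case: ltnP => // ge_j.
by rewrite prod_term0r // nth_default.
Qed.

Lemma weyl_prodDl b : {morph (@weyl_prod k)^~ b : a1 a2 / a1 + a2}.
Proof.
move=> a1 a2.
pose n := maxn (size (a1 : {poly {poly k}})) (size (a2 : {poly {poly k}})).
rewrite !(weyl_prodE (n := n) _ (leqnn _)) ?leq_maxl ?leq_maxr //; last first.
  exact: size_polyD.
rewrite -big_split; apply: eq_bigr => i _; rewrite -big_split.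
apply: eq_bigr => j _.
by rewrite /prod_term coefD subst_partialD mulrDl mactDl.
Qed.

Lemma weyl_prodDr a : {morph @weyl_prod k a : b1 b2 / b1 + b2}.
Proof.
move=> b1 b2.
pose m := maxn (size (b1 : {poly {poly k}})) (size (b2 : {poly {poly k}})).
rewrite !(weyl_prodE (m := m) (leqnn _)) ?leq_maxl ?leq_maxr //; last first.
  exact: size_polyD.
rewrite -big_split; apply: eq_bigr => i _; rewrite -big_split.
apply: eq_bigr => j _.
by rewrite /prod_term coefD subst_partialD mulrDr mactDl.
Qed.

Lemma weyl_prodXl a b :
  weyl_prod ('X *: a) b = mact (- 'X_ord0) (weyl_prod a b).
Proof.
rewrite !(weyl_prodE (n := size (a : {poly {poly k}})) _ (leqnn _)) ?size_scale_leq //.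
rewrite (morphD_sum (mactDr _)); apply: eq_bigr => i _.
rewrite (morphD_sum (mactDr _)); apply: eq_bigr => j _.
by rewrite /prod_term coefZ subst_partialX -mulrA mactA.
Qed.

Lemma weyl_prodXr a b :
  weyl_prod a ('X *: b) = mact ('X%:MP + 'X_ord0) (weyl_prod a b).
Proof.
rewrite !(weyl_prodE (m := size (b : {poly {poly k}})) (leqnn _)) ?size_scale_leq //.
rewrite (morphD_sum (mactDr _)); apply: eq_bigr => i _.
rewrite (morphD_sum (mactDr _)); apply: eq_bigr => j _.
by rewrite /prod_term coefZ subst_partialX mulrCA !mactA.
Qed.

Lemma weyl_prod_basis (c d : k) i j :
  weyl_prod (c%:P *: ('X^i : {poly {poly k}})) (d%:P *: ('X^j : {poly {poly k}})) =
  mact (c * d)%:P%:MP (weyl_basis_prod k i.+1 j.+1).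
Proof.
have le_size (e : k) l : (size (e%:P *: ('X^l : {poly {poly k}})) <= l.+1)%N.
  by rewrite (leq_trans (size_scale_leq _ _)) ?size_polyXn.
have sum_last l (h : nat -> lpoly (weyl k) 1) :
    (forall l', l' != l -> h l' = 0) -> \sum_(l' < l.+1) h l' = h l.
  move=> h0; rewrite big_ord_recr /= big1 ?add0r // => l' _.
  by apply: h0; rewrite ltn_eqF.
rewrite (weyl_prodE (le_size c i) (le_size d j)).
rewrite (sum_last i (fun i' => \sum_(j' < j.+1) prod_term _ _ i' j')); last first.
  move=> l neq; rewrite big1 // => l' _; apply: prod_term0l.
  by rewrite coefZ coefXn (negbTE neq) mulr0.
rewrite sum_last; last first.
  move=> l neq; apply: prod_term0r.
  by rewrite coefZ coefXn (negbTE neq) mulr0.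
rewrite /prod_term !coefZ !coefXn !eqxx !mulr1 !subst_partialC.
by rewrite -mpolyCM -polyCM.
Qed.

(** Coefficientwise application of [F], with λ fixed. *)
Notation lmap F := (mbind (fun _ : 'I_1 => 'X_ord0) (fun x => lcst 1 (F x))).

Let derivcD : {morph (fun x : weyl k => lcst 1 (weyl_deriv x)) : x y / x + y}.
Proof. by move=> x y; rewrite weyl_derivD lmonoD. Qed.

Lemma lmap_derivD :
  {morph (lmap (@weyl_deriv k) : lpoly (weyl k) 1 -> lpoly (weyl k) 1) : g h / g + h}.
Proof. exact: mbindD. Qed.

Lemma lmap_derivX i (g : lpoly (weyl k) 1) :
  lmap (@weyl_deriv k) (mact 'X_i g) = mact 'X_i (lmap (@weyl_deriv k) g).
Proof. by rewrite mbindX // [i]ord1. Qed.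

Lemma lmap_deriv_coef (c : k) (g : lpoly (weyl k) 1) :
  lmap (@weyl_deriv k) (mact c%:P%:MP g) = mact c%:P%:MP (lmap (@weyl_deriv k) g).
Proof.
elim/lpoly_ind: g => [x|i g IH|g1 g2 IH1 IH2].
- by rewrite mact_const !mbind_const // weyl_derivZ mact_const.
- by rewrite mactC !lmap_derivX IH mactC.
- by rewrite mactDr !lmap_derivD mactDr IH1 IH2.
Qed.

(** The Weyl relation [d/d∂, ∂] = 1 on coefficients. *)
Lemma lmap_deriv_partial (g : lpoly (weyl k) 1) :
  lmap (@weyl_deriv k) (mact 'X%:MP g) = g + mact 'X%:MP (lmap (@weyl_deriv k) g).
Proof.
elim/lpoly_ind: g => [x|i g IH|g1 g2 IH1 IH2].
- by rewrite mact_const !mbind_const // weyl_derivX lmonoD mact_const.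
- by rewrite mactC !lmap_derivX IH mactDr; congr (_ + _); apply: mactC.
- by rewrite mactDr !lmap_derivD mactDr IH1 IH2; apply: addrACA.
Qed.

Lemma weyl_basis_prodE n m : weyl_basis_prod k n m =
  \sum_(s < m.+1) mact ('X_ord0 ^+ s *+ 'C(m, s)) (lcst 1 (weyl_v k (n + (m - s)))).
Proof. by rewrite mact.unlock lmono.unlock. Qed.

Lemma lmap_deriv_basis n m : lmap (@weyl_deriv k) (weyl_basis_prod k n m) = 0.
Proof.
rewrite weyl_basis_prodE (morphD_sum lmap_derivD) big1 // => s _.
rewrite -mulr_natr mactA -mpolyC_nat -polyC_natr.
have lmapXn l g : lmap (@weyl_deriv k) (mact ('X_ord0 ^+ l) g) =
    mact ('X_ord0 ^+ l) (lmap (@weyl_deriv k) g).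
  elim: l => [|l IH]; first by rewrite expr0 !mact1.
  by rewrite exprS !mactA lmap_derivX IH.
rewrite lmapXn lmap_deriv_coef mbind_const //.
by rewrite weyl_derivXn lmonoD0 !mact0r.
Qed.

(** In p(-λ) q(∂+λ) v^n (v+λ)^m only q(∂+λ) involves ∂, and its derivative is q'(∂+λ). So d/d∂ acts
    on a product through the right factor alone, which makes it compatible with merging
    arguments. *)
Lemma lmap_deriv_prod a b :
  lmap (@weyl_deriv k) (weyl_prod a b) = weyl_prod a (weyl_deriv b).
Proof.
elim/weyl_ind: a => [c i|a IH|a1 a2 IH1 IH2]; last first.
- by rewrite !weyl_prodDl lmap_derivD IH1 IH2.
- rewrite !weyl_prodXl mactNl (morphDN lmap_derivD) lmap_derivX IH.
  by rewrite mactNl.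
elim/weyl_ind: b => [d j|b IH|b1 b2 IH1 IH2]; last first.
- by rewrite weyl_derivD !weyl_prodDr lmap_derivD IH1 IH2.
- rewrite weyl_derivX weyl_prodDr !weyl_prodXr !mactDl lmap_derivD.
  by rewrite lmap_deriv_partial lmap_derivX IH; rewrite -addrA.
rewrite weyl_prod_basis lmap_deriv_coef lmap_deriv_basis mact0r.
by rewrite weyl_derivZ weyl_derivXn scaler0 (morphD0 (weyl_prodDr _)).
Qed.

(* With a = a(∂,v), this says that d/dλ (a_λ v) + (da/d∂)_λ v = a(-λ,v), since
   a_λ v = a(-λ,v)(v+λ); an additive F with F (∂x) = -λ_i F x maps a(-λ,v) at
   λ = λ_i to F a. *)
Lemma mbind_lderiv_weyl_prod (M : lmodType {poly k}) n (i : 'I_n)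
    (F : weyl k -> lpoly M n) a :
    {morph F : x y / x + y} -> (forall x, F ('X *: x) = mact (- 'X_i) (F x)) ->
  mbind (fun _ : 'I_1 => 'X_i) F
    (lderiv ord0 (weyl_prod a (weyl_v k 1)) + weyl_prod (weyl_deriv a) (weyl_v k 1))
  = F a.
Proof.
move=> FD FX; elim/weyl_ind: a => [c j|a IH|a1 a2 IH1 IH2]; last first.
- rewrite weyl_derivD !weyl_prodDl lderivD FD -IH1 -IH2 -(mbindD _ FD).
  by congr mbind; apply: addrACA.
- rewrite weyl_derivX weyl_prodDl !weyl_prodXl FX -IH !mactNl.
  rewrite (morphDN (@lderivD _ _ _ _)) lderivX eqxx.
  set P := weyl_prod a _; set Q := weyl_prod _ _; set L := lderiv _ _.
  have -> : - (mact 'X_ord0 L + P) + (P - mact 'X_ord0 Q) = - mact 'X_ord0 (L + Q).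
    move: (mactDr 'X_ord0 L Q); move: (mact _ _) (mact _ L) (mact _ Q) => x y z ->.
    by rewrite opprD -addrA (addrA (- P)) addNr add0r -opprD.
  by rewrite (morphDN (mbindD _ FD)) mbindX.
rewrite weyl_derivZ weyl_derivXn scaler0 (morphD0 (weyl_prodDl _)) addr0.
have -> : weyl_v k 1 = (1%:P *: 'X^0 : {poly {poly k}}) by rewrite scale1r.
(* The base case: ['X^j] stands for v^(j+1), and v^(j+1) (v+λ) has λ-derivative v^(j+1). *)
rewrite weyl_prod_basis mulr1 weyl_basis_prodE !big_ord_recl big_ord0 addr0.
rewrite /= bin0 bin1 !mulr1n expr0 expr1 mact1 mactDr lderivD mactC lderivX eqxx.
rewrite !mact_const !lderiv_const mact0r !add0r mbind_const //.
by rewrite /weyl_v addn0.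
Qed.

End WeylTheory.


(** * Evaluation of the last variable *)

Section LastVariable.
Variable k : fieldType.

Definition kill_last n (i : 'I_n.+1) : {mpoly {poly k}[n]} :=
  if unlift ord_max i is Some j then 'X_j else 0.

Definition last_diff n (i : 'I_n.+2) : {mpoly {poly k}[n.+1]} :=
  if unlift ord_max i is Some j then (j == ord_max)%:R else - 1.

End LastVariable.

(* lim0 is evaluation at λ_n = 0, and ldiff is d/dλ_(n-1) - d/dλ_n followed by it. *)
Notation lim0 := (msubst (@kill_last _ _)).
Notation ldiff := (mtwist (@kill_last _ _) (@last_diff _ _)).

Section LastVariableTheory.
Variables (k : fieldType) (M : lmodType {poly k}).

Lemma lim0_lift n (j : 'I_n) (g : lpoly M n.+1) :
  lim0 (mact 'X_(lift ord_max j) g) = mact 'X_j (lim0 g).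
Proof. by rewrite msubstX /kill_last liftK. Qed.

Lemma lim0_max n (g : lpoly M n.+1) : lim0 (mact 'X_ord_max g) = 0.
Proof. by rewrite msubstX /kill_last unlift_none mact0l. Qed.

Lemma ldiff_lift n (j : 'I_n.+1) (g : lpoly M n.+2) :
  ldiff (mact 'X_(lift ord_max j) g) =
  mact 'X_j (ldiff g) + (if j == ord_max then lim0 g else 0).
Proof.
rewrite mtwistX /last_diff {1}/kill_last liftK.
by case: eqP => _; rewrite ?mact1 ?mact0l.
Qed.

Lemma ldiff_max n (g : lpoly M n.+2) : ldiff (mact 'X_ord_max g) = - lim0 g.
Proof.
by rewrite mtwistX /last_diff {1}/kill_last unlift_none mact0l mactNl mact1 add0r.
Qed.

(** The polynomial by which ∂ acts on cochains. *)
Definition total n : {mpoly {poly k}[n]} := 'X%:MP + \sum_(i < n) 'X_i.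

Let mact_total n (g : lpoly M n) :
  mact (total n) g = mact 'X%:MP g + \sum_(i < n) mact 'X_i g.
Proof. by rewrite mactDl (morphD_sum (mactDl g)). Qed.

Let lift_maxE n (i : 'I_n) : widen_ord (leqnSn n) i = lift ord_max i.
Proof. by apply/val_inj; rewrite /= /bump leqNgt ltn_ord. Qed.

Lemma lim0_total n (g : lpoly M n.+1) : lim0 (mact (total n.+1) g) = mact (total n) (lim0 g).
Proof.
rewrite !mact_total msubstD msubst_coef (morphD_sum (msubstD _)) big_ord_recr /=.
rewrite lim0_max addr0; congr (_ + _); apply: eq_bigr => i _.
by rewrite lift_maxE lim0_lift.
Qed.

(** The last two variables contribute [lim0 g] with opposite signs, and these cancel. *)
Lemma ldiff_total n (g : lpoly M n.+2) :
  ldiff (mact (total n.+2) g) = mact (total n.+1) (ldiff g).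
Proof.
rewrite !mact_total mtwistD mtwist_coef (morphD_sum (mtwistD _ _)) big_ord_recr /=.
rewrite ldiff_max; congr (_ + _).
rewrite (eq_bigr (fun i => mact 'X_i (ldiff g) + (if i == ord_max then lim0 g else 0))).
  rewrite big_split -big_mkcond big_pred1_eq /=.
  by move: (bigop _ _ _) (lim0 g) => x y; rewrite addrK.
by move=> i _; rewrite lift_maxE ldiff_lift.
Qed.

End LastVariableTheory.

(** * Basic cochains, one argument at a time *)

Section Cochains.
Variables (k : fieldType) (C M : lmodType {poly k}).

Lemma basic_cochainD n (phi : {ffun 'I_n -> C} -> lpoly M n) a i :
  basic_cochain phi -> {morph (fun x => phi (subst_arg a i x)) : x y / x + y}.
Proof.
by case=> + _ x y => /(_ a i 1 x y); rewrite polyC1 scale1r -!mactE mact1.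
Qed.

Lemma basic_cochainZ n (phi : {ffun 'I_n -> C} -> lpoly M n) a i (c : k) x :
  basic_cochain phi ->
  phi (subst_arg a i (c%:P *: x)) = mact c%:P%:MP (phi (subst_arg a i x)).
Proof.
move=> phiC; have := phiC.1 a i c x 0.
by rewrite addr0 (morphD0 (basic_cochainD a i phiC)) addr0 mactE.
Qed.

Lemma basic_cochainX n (phi : {ffun 'I_n -> C} -> lpoly M n) a i x :
  basic_cochain phi ->
  phi (subst_arg a i ('X *: x)) = mact (- 'X_i) (phi (subst_arg a i x)).
Proof. by move=> phiC; rewrite phiC.2 mactE. Qed.

Lemma basic_cochainP n (phi : {ffun 'I_n -> C} -> lpoly M n) :
    (forall a i, {morph (fun x => phi (subst_arg a i x)) : x y / x + y}) ->
    (forall a i c x,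
       phi (subst_arg a i (c%:P *: x)) = mact c%:P%:MP (phi (subst_arg a i x))) ->
    (forall a i x,
       phi (subst_arg a i ('X *: x)) = mact (- 'X_i) (phi (subst_arg a i x))) ->
  basic_cochain phi.
Proof.
move=> phiD phiZ phiX; split=> [a i c x y|a i x]; first by rewrite phiD phiZ mactE.
by rewrite phiX mactE.
Qed.

Lemma basic_cochainMz n (phi : {ffun 'I_n -> C} -> lpoly M n) z :
  basic_cochain phi -> basic_cochain (fun a => phi a *~ z).
Proof.
move=> phiC; apply: basic_cochainP => [a i x y|a i c x|a i x].
- by rewrite (basic_cochainD a i phiC) mulrzDl.
- by rewrite basic_cochainZ // (morphDMz (mactDr _)).
- by rewrite basic_cochainX // (morphDMz (mactDr _)).
Qed.

Lemma cochain_partialE n (phi : {ffun 'I_n -> C} -> lpoly M n) a :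
  cochain_partial phi a = mact (total k n) (phi a).
Proof. by rewrite mactE. Qed.

Variables (prod : C -> C -> lpoly C 1) (act : C -> M -> lpoly M 1).

Lemma hochschild_dE n (phi : {ffun 'I_n -> C} -> lpoly M n) a :
  hochschild_d prod act phi a =
  mbind (fun j : 'I_n => 'X_(lift ord0 j))
    (fun x => msubst (fun _ : 'I_1 => 'X_ord0) (act (a ord0) x))
    (phi [ffun j => a (lift ord0 j)])
  + \sum_(i < n)
      mbind (fun _ : 'I_1 => 'X_(pos0 i))
        (fun c => msubst (merge_vars k i) (phi (merge_args a i c)))
        (prod (a (pos0 i)) (a (pos1 i))) *~ (-1) ^+ i.+1.
Proof. by rewrite mbind.unlock lmono.unlock. Qed.

End Cochains.


(** * The contracting homotopy *)

Section Positions.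

Lemma lift_maxK n (i : 'I_n) : val (lift ord_max i) = i.
Proof. by rewrite /= /bump leqNgt ltn_ord. Qed.

Lemma lift0_max n : lift ord0 (ord_max : 'I_n.+1) = ord_max.
Proof. exact/val_inj. Qed.

Lemma lift0_lift_max n (i : 'I_n) : lift ord0 (lift ord_max i) = lift ord_max (lift ord0 i).
Proof. by apply/val_inj; rewrite lift_maxK /= /bump /= leqNgt ltn_ord. Qed.

Lemma lift_max_eq n (i j : 'I_n) : (lift ord_max i == lift ord_max j) = (i == j).
Proof. exact: (inj_eq (@lift_inj _ _)). Qed.

Lemma pos0_lift n (i : 'I_n) : pos0 (lift ord_max i) = lift ord_max (pos0 i).
Proof. by apply/val_inj; rewrite lift_maxK /= /bump leqNgt ltn_ord. Qed.

Lemma pos1_lift n (i : 'I_n) : pos1 (lift ord_max i) = lift ord_max (pos1 i).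
Proof. exact: lift0_lift_max. Qed.

Lemma pos0_neq_max n (i : 'I_n) : (pos0 i == ord_max) = false.
Proof. by rewrite -val_eqE /= ltn_eqF. Qed.

Lemma pos0_max n : pos0 (ord_max : 'I_n.+1) = lift ord_max ord_max.
Proof. by apply/val_inj; rewrite lift_maxK. Qed.

Lemma pos1_eq_max n (i : 'I_n.+1) : (pos1 i == ord_max) = (i == ord_max).
Proof. by rewrite /pos1 -lift0_max (inj_eq (@lift_inj _ _)). Qed.

Lemma skip_max n (j : 'I_n.+1) : skip ord_max j = lift ord_max j.
Proof. by rewrite /skip /pos1 lift0_max. Qed.

Lemma skip_lift n (i j : 'I_n) :
  skip (lift ord_max i) (lift ord_max j) = lift ord_max (skip i j).
Proof.
apply/val_inj; rewrite lift_maxK /skip pos1_lift /=.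
by rewrite /bump !add1n ![(n < _)%N]leqNgt !ltnS ![(n <= _)%N]leqNgt !ltn_ord.
Qed.

Lemma skip_lift_max n (i : 'I_n) : skip (lift ord_max i) ord_max = ord_max.
Proof.
apply/val_inj; rewrite /skip pos1_lift /= /bump leq0n add1n.
by rewrite [(n < _)%N]leqNgt ltnS ltn_ord add0n ltn_ord.
Qed.

Lemma skip_max_neq n (j : 'I_n.+1) : (skip ord_max j == ord_max) = false.
Proof. by rewrite skip_max eq_sym (negbTE (neq_lift _ _)). Qed.

Lemma skip_eq_max n (i j : 'I_n.+1) : i != ord_max ->
  (skip i j == ord_max) = (j == ord_max).
Proof.
case: (unliftP ord_max i) => [{}i ->|->]; last by rewrite eqxx.
case: (unliftP ord_max j) => [{}j ->|->] _; last by rewrite skip_lift_max !eqxx.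
by rewrite skip_lift ![lift _ _ == _]eq_sym !(negbTE (neq_lift _ _)).
Qed.


End Positions.

(** * The homotopy on basic cochains *)

Section Homotopy.
Variables (k : fieldType) (M : lmodType {poly k}).
Local Notation C := (weyl k).
Local Notation D := (@weyl_deriv k).

Definition append_v n (a : {ffun 'I_n -> C}) : {ffun 'I_n.+1 -> C} :=
  [ffun i => if unlift ord_max i is Some j then a j else weyl_v k 1].

Definition deriv_last n (a : {ffun 'I_n.+1 -> C}) : {ffun 'I_n.+1 -> C} :=
  subst_arg a ord_max (D (a ord_max)).

(** The source has degree at least 2: besides the variable set to 0, the formula needs a variable
    before it to differentiate in. *)
Definition homotopy n (phi : {ffun 'I_n.+2 -> C} -> lpoly M n.+2)
    (a : {ffun 'I_n.+1 -> C}) : lpoly M n.+1 :=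
  ldiff (phi (append_v a)) + lim0 (phi (append_v (deriv_last a))).

Lemma append_v_lift n (a : {ffun 'I_n -> C}) j : append_v a (lift ord_max j) = a j.
Proof. by rewrite ffunE liftK. Qed.

Lemma append_v_max n (a : {ffun 'I_n -> C}) : append_v a ord_max = weyl_v k 1.
Proof. by rewrite ffunE unlift_none. Qed.

Lemma append_v_subst n (a : {ffun 'I_n -> C}) i x :
  append_v (subst_arg a i x) = subst_arg (append_v a) (lift ord_max i) x.
Proof.
apply/ffunP => j; rewrite [RHS]ffunE; case: (unliftP ord_max j) => [{}j ->|->].
  by rewrite !append_v_lift ffunE lift_max_eq.
by rewrite !append_v_max (negbTE (neq_lift _ _)).
Qed.

Lemma subst_argE n (a : {ffun 'I_n -> C}) i x : subst_arg a i x i = x.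
Proof. by rewrite ffunE eqxx. Qed.

Lemma subst_arg_id n (a : {ffun 'I_n -> C}) i : subst_arg a i (a i) = a.
Proof. by apply/ffunP => j; rewrite ffunE; case: eqP => [->|]. Qed.

Lemma subst_argK n (a : {ffun 'I_n -> C}) i x y :
  subst_arg (subst_arg a i x) i y = subst_arg a i y.
Proof. by apply/ffunP => j; rewrite !ffunE; case: eqP. Qed.

Lemma deriv_last_subst_max n (a : {ffun 'I_n.+1 -> C}) x :
  deriv_last (subst_arg a ord_max x) = subst_arg a ord_max (D x).
Proof. by rewrite /deriv_last subst_argE subst_argK. Qed.

Lemma deriv_last_subst n (a : {ffun 'I_n.+1 -> C}) i x : i != ord_max ->
  deriv_last (subst_arg a i x) = subst_arg (deriv_last a) i x.
Proof.
move=> neq; apply/ffunP => j; rewrite !ffunE [ord_max == i]eq_sym (negbTE neq).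
by case: (j =P ord_max) => [->|//]; rewrite eq_sym (negbTE neq).
Qed.

(** Only multiplication of the last argument by ∂ is delicate. There the Leibniz rule for [ldiff]
    produces an extra [- lim0], and D(∂x) = x + ∂ D x produces the [lim0] that cancels it. *)
Lemma homotopy_cochain n (phi : {ffun 'I_n.+2 -> C} -> lpoly M n.+2) :
  basic_cochain phi -> basic_cochain (homotopy phi).
Proof.
move=> phiC; have phiD a i := basic_cochainD a i phiC.
apply: basic_cochainP => [a i x y|a i c x|a i x]; rewrite /homotopy.
- have [->|neq] := eqVneq i ord_max.
    rewrite !deriv_last_subst_max !append_v_subst weyl_derivD !phiD.
    by rewrite mtwistD msubstD; apply: addrACA.
  rewrite !deriv_last_subst // !append_v_subst !phiD mtwistD msubstD.
  exact: addrACA.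
- have [->|neq] := eqVneq i ord_max.
    rewrite !deriv_last_subst_max !append_v_subst weyl_derivZ !basic_cochainZ //.
    by rewrite mtwist_coef msubst_coef -mactDr.
  rewrite !deriv_last_subst // !append_v_subst !basic_cochainZ //.
  by rewrite mtwist_coef msubst_coef -mactDr.
- have [->|neq] := eqVneq i ord_max.
    rewrite !deriv_last_subst_max !append_v_subst weyl_derivX phiD !basic_cochainX //.
    rewrite !mactNl (morphDN (@mtwistD _ _ _ _ _ _)) msubstD (morphDN (@msubstD _ _ _ _ _)).
    rewrite ldiff_lift eqxx lim0_lift mactDr.
    move: (mact _ _) (mact _ _) (lim0 _) => x1 x2 x3.
    by rewrite opprD -addrA (addrA (- _) x3) addNr add0r -opprD.
  rewrite !deriv_last_subst // !append_v_subst !basic_cochainX // !mactNl.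
  rewrite (morphDN (@mtwistD _ _ _ _ _ _)) (morphDN (@msubstD _ _ _ _ _)).
  by rewrite ldiff_lift (negbTE neq) addr0 lim0_lift mactDr opprD.
Qed.

Lemma homotopy_partial n (phi : {ffun 'I_n.+2 -> C} -> lpoly M n.+2) a :
  homotopy (cochain_partial phi) a = cochain_partial (homotopy phi) a.
Proof.
by rewrite /homotopy !cochain_partialE ldiff_total lim0_total -mactDr.
Qed.

(** * The homotopy against each summand of the differential *)

Section Differential.
Variable act : C -> M -> lpoly M 1.
Hypothesis actD : forall a, {morph act a : x y / x + y}.

Let shift n x m : lpoly M n.+1 := msubst (fun _ : 'I_1 => 'X_ord0) (act x m).
Let shiftD n x : {morph @shift n x : y z / y + z}.
Proof. by move=> y z; rewrite /shift actD msubstD. Qed.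

(** The first summand of the differential, the action of [x] in λ_1 on a value of the cochain with
    its variables moved up by one. *)
Let lead n x (g : lpoly M n) : lpoly M n.+1 :=
  mbind (fun j : 'I_n => 'X_(lift ord0 j)) (@shift n x) g.

Let leadD n x : {morph @lead n x : g h / g + h}.
Proof. exact/mbindD/shiftD. Qed.

Let leadX n x i (g : lpoly M n) : lead x (mact 'X_i g) = mact 'X_(lift ord0 i) (lead x g).
Proof. exact/mbindX/shiftD. Qed.

Let lead_const n x y : lead x (lcst n y) = shift n x y.
Proof. exact/mbind_const/shiftD. Qed.

Let lim0_shift n x y : lim0 (shift n.+1 x y) = shift n x y.
Proof.
rewrite /shift (morph_mbind (f' := fun=> 'X_ord0)).
- by apply: eq_mbind => // z; rewrite /= msubst_const.
- exact: lmonoD.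
- exact: msubstD.
move=> i g; have -> : ord0 = lift ord_max (ord0 : 'I_n.+1) by exact/val_inj.
exact: lim0_lift.
Qed.

(** Only λ_1 occurs, and among at least three variables it is not one of the last two. *)
Let ldiff_shift n x y : ldiff (shift n.+2 x y) = 0.
Proof.
rewrite /shift; elim/lpoly_ind: (act x y) => [z|i g IH|g1 g2 IH1 IH2].
- by rewrite msubst_const mtwist_const.
- have -> : ord0 = lift ord_max (ord0 : 'I_n.+2) by exact/val_inj.
  by rewrite msubstX ldiff_lift IH mact0r add0r.
- by rewrite msubstD mtwistD IH1 IH2 addr0.
Qed.

Let lim0_lead n x (g : lpoly M n.+1) : lim0 (lead x g) = lead x (lim0 g).
Proof.
elim/lpoly_ind: g => [y|i g IH|g1 g2 IH1 IH2].
- by rewrite msubst_const !lead_const lim0_shift.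
- rewrite leadX; case: (unliftP ord_max i) => [j ->|->].
    by rewrite lift0_lift_max !lim0_lift leadX IH.
  by rewrite lift0_max !lim0_max (morphD0 (leadD x)).
- by rewrite leadD !msubstD leadD IH1 IH2.
Qed.

(** Moving the variables up by one keeps the last two of them last, and the new variable λ_1 is not
    differentiated. *)
Let ldiff_lead n x (g : lpoly M n.+2) : ldiff (lead x g) = lead x (ldiff g).
Proof.
elim/lpoly_ind: g => [y|i g IH|g1 g2 IH1 IH2].
- by rewrite mtwist_const lead_const ldiff_shift (morphD0 (leadD x)).
- rewrite leadX; case: (unliftP ord_max i) => [j ->|->].
    rewrite lift0_lift_max !ldiff_lift leadD leadX IH; congr (_ + _).
    rewrite -[in X in if X then _ else _]lift0_max (inj_eq (@lift_inj _ _)).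
    by case: eqP => _; rewrite ?(morphD0 (leadD x)) // lim0_lead.
  by rewrite lift0_max !ldiff_max (morphDN (leadD x)) lim0_lead.
- by rewrite leadD !mtwistD leadD IH1 IH2.
Qed.

Let lim0_merge n (i : 'I_n) (g : lpoly M n.+1) :
  lim0 (msubst (merge_vars k (lift ord_max i)) g) = msubst (merge_vars k i) (lim0 g).
Proof.
elim/lpoly_ind: g => [x|j g IH|g1 g2 IH1 IH2].
- by rewrite !msubst_const.
- rewrite msubstX; case: (unliftP ord_max j) => [{}j ->|->].
    rewrite lim0_lift msubstX -IH /merge_vars lift_max_eq.
    case: eqP => _; last by rewrite skip_lift lim0_lift.
    by rewrite pos0_lift pos1_lift !mactDl msubstD !lim0_lift.
  rewrite /merge_vars (negbTE (neq_lift _ _)) skip_lift_max !lim0_max.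
  by rewrite (morphD0 (@msubstD _ _ _ _ _)).
- by rewrite !msubstD IH1 IH2.
Qed.

Let merge_vars_eq n (i : 'I_n) : merge_vars k i i = 'X_(pos0 i) + 'X_(pos1 i).
Proof. by rewrite /merge_vars eqxx. Qed.

Let merge_vars_neq n (i j : 'I_n) : j != i -> merge_vars k i j = 'X_(skip i j).
Proof. by rewrite /merge_vars => /negbTE ->. Qed.

(** The last variable is kept apart from the merge. If [i] is the top index, the last but one
    variable becomes a sum ending in the new last but one variable, so its derivative is still 1. *)
Let ldiff_merge n (i : 'I_n.+1) (g : lpoly M n.+2) :
  ldiff (msubst (merge_vars k (lift ord_max i)) g) = msubst (merge_vars k i) (ldiff g).
Proof.
elim/lpoly_ind: g => [x|j g IH|g1 g2 IH1 IH2].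
- by rewrite !msubst_const !mtwist_const (morphD0 (@msubstD _ _ _ _ _)).
- rewrite msubstX; case: (unliftP ord_max j) => [{}j ->|->].
    rewrite ldiff_lift msubstD msubstX -IH.
    have [->|neq] := eqVneq j i.
      rewrite !merge_vars_eq pos0_lift pos1_lift !mactDl mtwistD !ldiff_lift.
      rewrite pos0_neq_max addr0 pos1_eq_max -addrA; congr (_ + (_ + _)).
      by case: eqP => _; rewrite ?(morphD0 (@msubstD _ _ _ _ _)) // lim0_merge.
    rewrite !merge_vars_neq ?lift_max_eq // skip_lift ldiff_lift; congr (_ + _).
    have [i_max|i_neq] := eqVneq i ord_max.
      by rewrite i_max skip_max_neq -i_max (negbTE neq) (morphD0 (@msubstD _ _ _ _ _)).
    rewrite skip_eq_max //.
    by case: eqP => _; rewrite ?(morphD0 (@msubstD _ _ _ _ _)) // lim0_merge.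
  rewrite merge_vars_neq ?neq_lift // skip_lift_max !ldiff_max.
  by rewrite (morphDN (@msubstD _ _ _ _ _)) lim0_merge.
- by rewrite !(msubstD, mtwistD) IH1 IH2.
Qed.

Let merge_max_maxE n (j : 'I_n.+1) : merge_vars k ord_max j =
  if j == ord_max then 'X_(lift ord_max ord_max) + 'X_ord_max
  else 'X_(lift ord_max j).
Proof. by rewrite /merge_vars pos0_max /pos1 lift0_max skip_max. Qed.

Let lim0_merge_max n (g : lpoly M n.+1) : lim0 (msubst (merge_vars k ord_max) g) = g.
Proof.
elim/lpoly_ind: g => [x|j g IH|g1 g2 IH1 IH2].
- by rewrite !msubst_const.
- rewrite msubstX merge_max_maxE.
  have [->|_] := eqVneq j ord_max; last by rewrite lim0_lift IH.
  by rewrite mactDl msubstD lim0_lift lim0_max addr0 IH.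
- by rewrite !msubstD IH1 IH2.
Qed.

(** After this merge the last two variables occur only through their sum, which the difference of
    the two partial derivatives kills. *)
Let ldiff_merge_max n (g : lpoly M n.+1) : ldiff (msubst (merge_vars k ord_max) g) = 0.
Proof.
elim/lpoly_ind: g => [x|j g IH|g1 g2 IH1 IH2].
- by rewrite msubst_const mtwist_const.
- rewrite msubstX merge_max_maxE; have [_|neq] := eqVneq j ord_max.
    by rewrite mactDl mtwistD ldiff_lift eqxx ldiff_max IH mact0r add0r addrN.
  by rewrite ldiff_lift IH mact0r add0r (negbTE neq).
- by rewrite !(msubstD, mtwistD) IH1 IH2 addr0.
Qed.

Let merge_append n (a : {ffun 'I_n.+1 -> C}) (i : 'I_n) c :
  merge_args (append_v a) (lift ord_max i) c = append_v (merge_args a i c).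
Proof.
apply/ffunP => j; rewrite ffunE; case: (unliftP ord_max j) => [{}j ->|->].
  by rewrite lift_max_eq skip_lift !append_v_lift [RHS]ffunE.
by rewrite (negbTE (neq_lift _ _)) skip_lift_max !append_v_max.
Qed.

Let merge_append_max n (a : {ffun 'I_n.+1 -> C}) c :
  merge_args (append_v a) ord_max c = subst_arg a ord_max c.
Proof.
by apply/ffunP => j; rewrite ffunE [RHS]ffunE skip_max append_v_lift.
Qed.

Let deriv_last_neq n (a : {ffun 'I_n.+1 -> C}) i : i != ord_max -> deriv_last a i = a i.
Proof. by move=> /negbTE neq; rewrite ffunE neq. Qed.

Let merge_deriv_last n (a : {ffun 'I_n.+2 -> C}) (i : 'I_n.+1) c : i != ord_max ->
  merge_args (deriv_last a) i c = deriv_last (merge_args a i c).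
Proof.
move=> neq; apply/ffunP => j; have [->|j_neq] := eqVneq j ord_max.
  rewrite ffunE [ord_max == i]eq_sym (negbTE neq).
  have max_skip : skip i ord_max = ord_max by apply/eqP; rewrite skip_eq_max.
  rewrite max_skip /deriv_last !subst_argE [in RHS]ffunE [ord_max == i]eq_sym.
  by rewrite (negbTE neq) max_skip.
rewrite deriv_last_neq // !ffunE; case: eqP => // _.
by rewrite skip_eq_max // (negbTE j_neq).
Qed.

Let merge_deriv_last_max n (a : {ffun 'I_n.+2 -> C}) c :
  merge_args (deriv_last a) ord_max c = merge_args a ord_max c.
Proof. by apply/ffunP => j; rewrite !ffunE skip_max_neq. Qed.

Let append_tail n (a : {ffun 'I_n.+1 -> C}) :
  [ffun j => append_v a (lift ord0 j)] = append_v [ffun j => a (lift ord0 j)].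
Proof.
apply/ffunP => j; rewrite ffunE; case: (unliftP ord_max j) => [{}j ->|->].
  by rewrite lift0_lift_max !append_v_lift ffunE.
by rewrite lift0_max !append_v_max.
Qed.

Let deriv_last_tail n (a : {ffun 'I_n.+2 -> C}) :
  [ffun j => deriv_last a (lift ord0 j)] = deriv_last [ffun j => a (lift ord0 j)].
Proof.
apply/ffunP => j; rewrite !ffunE lift0_max.
by rewrite -[X in _ == X]lift0_max (inj_eq (@lift_inj _ _)).
Qed.

Let merged n (phi : {ffun 'I_n -> C} -> lpoly M n) (a : {ffun 'I_n.+1 -> C}) i :=
  mbind (fun _ : 'I_1 => 'X_(pos0 i))
    (fun c => msubst (merge_vars k i) (phi (merge_args a i c)))
    (weyl_prod (a (pos0 i)) (a (pos1 i))).

Section Homotopies.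
Variables (n : nat) (phi : {ffun 'I_n.+2 -> C} -> lpoly M n.+2).
Hypothesis phiC : basic_cochain phi.

(** The 0 is a placeholder overwritten by [c]; in this form linearity of [phi] in one argument
    applies. *)
Let merge_as_subst m (a : {ffun 'I_m.+1 -> C}) (i : 'I_m) c :
  merge_args a i c = subst_arg (merge_args a i 0) i c.
Proof. by apply/ffunP => j; rewrite !ffunE; case: eqP. Qed.

Let phi_mergeD a i : {morph (fun c => phi (merge_args a i c)) : x y / x + y}.
Proof.
move=> x y; have := basic_cochainD (merge_args a i 0) i phiC x y.
by rewrite /= -!merge_as_subst.
Qed.

(** A merge that does not involve the appended v commutes with both halves of the homotopy. *)
Let homotopy_merged a (i : 'I_n.+1) :
  ldiff (merged phi (append_v a) (lift ord_max i)) +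
    lim0 (merged phi (append_v (deriv_last a)) (lift ord_max i)) =
  merged (homotopy phi) a i.
Proof.
rewrite /merged /homotopy !pos0_lift !pos1_lift !append_v_lift.
rewrite (morph_mbind (Phi := ldiff) (f' := fun=> 'X_(pos0 i))); first last.
- by move=> _ g; rewrite ldiff_lift pos0_neq_max addr0.
- exact: mtwistD.
- by move=> x y; rewrite phi_mergeD msubstD.
rewrite (morph_mbind (Phi := lim0) (f' := fun=> 'X_(pos0 i))); first last.
- by move=> _ g; rewrite lim0_lift.
- exact: msubstD.
- by move=> x y; rewrite phi_mergeD msubstD.
pose F c := msubst (merge_vars k i) (ldiff (phi (append_v (merge_args a i c)))).
pose G c := msubst (merge_vars k i) (lim0 (phi (append_v (deriv_last (merge_args a i c))))).
have FD : {morph F : x y / x + y}.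
  by move=> x y; rewrite /F -!merge_append phi_mergeD mtwistD msubstD.
rewrite [X in X + _](eq_mbind (f' := fun=> 'X_(pos0 i)) (F' := F)) => [|//|c]; last first.
  by rewrite /= ldiff_merge merge_append.
rewrite [RHS](eq_mbind (f' := fun=> 'X_(pos0 i)) (F' := fun c => F c + G c))
  => [|//|c]; last first.
  by rewrite msubstD.
rewrite (deriv_last_neq _ (negbT (pos0_neq_max i))).
have [i_max|i_neq] := eqVneq i ord_max; last first.
  rewrite [X in _ + X](eq_mbind (f' := fun=> 'X_(pos0 i)) (F' := G)) => [|//|c]; last first.
    by rewrite /= lim0_merge merge_append merge_deriv_last.
  rewrite (deriv_last_neq _ (_ : pos1 i != ord_max)) ?pos1_eq_max //.
  rewrite mbind_addF // => x y.
  by rewrite /G -!merge_deriv_last // -!merge_append phi_mergeD !msubstD.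
(* Here the last two entries of [a] are merged. On the left D is applied to the right factor of the
   λ-product, on the right to the product itself, and [lmap_deriv_prod] identifies the two. *)
have pos1i : pos1 i = ord_max by apply/eqP; rewrite pos1_eq_max i_max.
pose K c := msubst (merge_vars k i) (lim0 (phi (append_v (merge_args a i c)))).
have KD : {morph K : x y / x + y}.
  by move=> x y; rewrite /K -!merge_append phi_mergeD !msubstD.
have GE c : G c = K (D c).
  rewrite /G /K i_max; congr (msubst _ (lim0 (phi (append_v _)))).
  apply/ffunP => j; rewrite !ffunE eqxx.
  by case: eqP.
have GD : {morph G : x y / x + y}.
  by move=> x y; rewrite !GE weyl_derivD KD.
rewrite [X in _ + X](eq_mbind (f' := fun=> 'X_(pos0 i)) (F' := K)) => [|//|c]; last first.
  by rewrite /= lim0_merge merge_append /K i_max merge_deriv_last_max.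
rewrite mbind_addF //; congr (_ + _).
rewrite pos1i /deriv_last subst_argE -lmap_deriv_prod.
rewrite (morph_mbind (f' := fun=> 'X_(pos0 i))); first last.
- by move=> _ g; rewrite mbindX.
- exact: mbindD.
- by move=> x y; rewrite weyl_derivD lmonoD.
by apply: eq_mbind => // c; rewrite /= mbind_const // GE.
Qed.

(** The λ of the product is the last but one variable and [F] is killed by [ldiff], so by the
    Leibniz rule the derivative falls on [g] alone. *)
Let ldiff_mbind_pen m (F : C -> lpoly M m.+2) (K : C -> lpoly M m.+1) (g : lpoly C 1) :
    {morph F : x y / x + y} -> (forall c, ldiff (F c) = 0) ->
    (forall c, lim0 (F c) = K c) ->
  ldiff (mbind (fun=> 'X_(lift ord_max ord_max)) F g) =
  mbind (fun=> 'X_ord_max) K (lderiv ord0 g).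
Proof.
move=> FD ldiffF lim0F.
have KD : {morph K : x y / x + y} by move=> x y; rewrite -!lim0F FD msubstD.
elim/lpoly_ind: g => [c|i g IH|g1 g2 IH1 IH2].
- by rewrite lderiv_const mbind_const // ldiffF (morphD0 (mbindD _ KD)).
- rewrite mbindX // ldiff_lift eqxx IH [i]ord1 lderivX eqxx mbindD // mbindX //.
  congr (_ + _); rewrite (morph_mbind (Phi := lim0) (f' := fun=> 'X_ord_max)) //.
  + exact: eq_mbind.
  + exact: msubstD.
  + by move=> _ y; rewrite lim0_lift.
- by rewrite mbindD // mtwistD lderivD mbindD // IH1 IH2.
Qed.

(** Merging the last entry x of [a] with the appended v makes the derivative fall on the product
    x_(λ) v, while the second half of the homotopy gives (D x)_(λ) v. By [mbind_lderiv_weyl_prod]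
    they add up to [phi a]. *)
Let homotopy_merged_max a :
  ldiff (merged phi (append_v a) ord_max) +
    lim0 (merged phi (append_v (deriv_last a)) ord_max) = phi a.
Proof.
pose K c := phi (subst_arg a ord_max c).
have KD : {morph K : x y / x + y} by exact: basic_cochainD.
have mergedE b : (forall c, subst_arg b ord_max c = subst_arg a ord_max c) ->
  merged phi (append_v b) ord_max = mbind (fun=> 'X_(lift ord_max ord_max))
    (fun c => msubst (merge_vars k ord_max) (K c)) (weyl_prod (b ord_max) (weyl_v k 1)).
  move=> b_a; rewrite /merged /pos1 lift0_max pos0_max append_v_lift append_v_max.
  by apply: eq_mbind => // c; rewrite merge_append_max b_a.
rewrite !mergedE // => [|c]; last by rewrite /deriv_last subst_argK.
have FD : {morph (fun c => msubst (merge_vars k ord_max) (K c) : lpoly M n.+3) : x y / x + y}.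
  by move=> x y; rewrite KD msubstD.
rewrite (ldiff_mbind_pen _ FD (fun c => ldiff_merge_max (K c))
  (fun c => lim0_merge_max (K c))).
rewrite (morph_mbind (Phi := lim0) (f' := fun=> 'X_ord_max)) //; first last.
- by move=> _ y; rewrite lim0_lift.
- exact: msubstD.
rewrite [X in _ + X](eq_mbind (f' := fun=> 'X_ord_max) (F' := K)) // => [|c]; last first.
  exact: lim0_merge_max.
rewrite -mbindD // /deriv_last subst_argE mbind_lderiv_weyl_prod //.
  by rewrite /K subst_arg_id.
by move=> x; apply: basic_cochainX.
Qed.

(** All summands but the last correspond one to one, with equal signs. The last one, of index n+1
    counted from 0, carries the sign (-1)^(n+2) and returns [phi]. *)
Lemma homotopy_differential a :
  homotopy (hochschild_d (@weyl_prod k) act phi) a =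
  hochschild_d (@weyl_prod k) act (homotopy phi) a + phi a *~ (-1) ^+ n.+2.
Proof.
have dE m (psi : {ffun 'I_m -> C} -> lpoly M m) b :
    hochschild_d (@weyl_prod k) act psi b =
    lead (b ord0) (psi [ffun j => b (lift ord0 j)]) +
    \sum_(i < m) merged psi b i *~ (-1) ^+ i.+1 by exact: hochschild_dE.
have append0 m (b : {ffun 'I_m.+1 -> C}) : append_v b ord0 = b ord0.
  have -> : ord0 = lift ord_max (ord0 : 'I_m.+1) by exact/val_inj.
  by rewrite append_v_lift.
rewrite /homotopy !dE !append0 deriv_last_neq // !append_tail deriv_last_tail.
rewrite mtwistD msubstD ldiff_lead lim0_lead leadD.
rewrite (morphD_sum (mtwistD _ _)) (morphD_sum (msubstD _)).
set x1 := lead _ _; set x2 := lead _ _; set s1 := bigop _ _ _; set s2 := bigop _ _ _.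
have -> : x1 + s1 + (x2 + s2) = x1 + x2 + (s1 + s2) by apply: addrACA.
rewrite -[RHS]addrA; congr (_ + _).
rewrite /s1 /s2 -big_split big_ord_recr /=; congr (_ + _).
  apply: eq_bigr => i _.
  have -> : widen_ord (leqnSn n.+1) i = lift ord_max i.
    by apply/val_inj; rewrite lift_maxK.
  rewrite (morphDMz (mtwistD _ _)) (morphDMz (msubstD _)) -mulrzDl.
  by rewrite homotopy_merged.
by rewrite (morphDMz (mtwistD _ _)) (morphDMz (msubstD _)) -mulrzDl homotopy_merged_max.
Qed.

End Homotopies.

End Differential.

End Homotopy.

(** * Signs and the vanishing of reduced cohomology *)

Lemma eq_sumMz (V : zmodType) (I : finType) (F G : I -> V) (e : I -> int) z :
    (forall i, F i = G i *~ z) ->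
  \sum_i F i *~ e i = (\sum_i G i *~ e i) *~ z.
Proof.
by move=> FG; rewrite mulrz_suml; apply: eq_bigr => i _; rewrite FG mulrzAC.
Qed.

Lemma hochschild_dMz (k : fieldType) (C M : lmodType {poly k})
    (prod : C -> C -> lpoly C 1) (act : C -> M -> lpoly M 1) n
    (phi : {ffun 'I_n -> C} -> lpoly M n) z a :
    (forall x, {morph act x : y1 y2 / y1 + y2}) -> basic_cochain phi ->
  hochschild_d prod act (fun b => phi b *~ z) a = hochschild_d prod act phi a *~ z.
Proof.
move=> actD phiC; rewrite !hochschild_dE mulrzDl; congr (_ + _).
  have leadD : {morph (fun x => msubst (fun _ : 'I_1 => 'X_ord0 : {mpoly {poly k}[n.+1]})
      (act (a ord0) x)) : x y / x + y} by move=> x y; rewrite actD msubstD.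
  by rewrite (morphDMz (mbindD _ leadD)).
apply: eq_sumMz => i.
have mergeE c : merge_args a i c = subst_arg (merge_args a i 0) i c.
  by apply/ffunP => j; rewrite !ffunE; case: eqP.
have phiD : {morph (fun c => phi (merge_args a i c)) : x y / x + y}.
  move=> x y; have := basic_cochainD (merge_args a i 0) i phiC x y.
  by rewrite /= -!mergeE.
rewrite (morph_mbind (Phi := fun y => y *~ z) (f' := fun=> 'X_(pos0 i))); first last.
- by move=> _ y; rewrite (morphDMz (mactDr _)).
- by move=> x y; rewrite mulrzDl.
- by move=> x y; rewrite phiD msubstD.
by apply: eq_mbind => // c; rewrite /= (morphDMz (@msubstD _ _ _ _ _)).
Qed.

Lemma act_morphD (k : fieldType) (C M : lmodType {poly k}) (act : C -> M -> lpoly M 1) x :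
  lambda_bilinear act -> {morph act x : y z / y + z}.
Proof.
by case=> _ + _ _ y z => /(_ 1 x y z); rewrite polyC1 scale1r -mactE mact1.
Qed.

Lemma weyl_reduced_cohomology_eq0 (k : fieldType) (M : lmodType {poly k})
    (act : weyl k -> M -> lpoly M 1) n :
  lambda_bilinear act -> reduced_cohomology_eq0 (@weyl_prod k) act n.+2.
Proof.
move=> act_bilin phi [phiC [chi chiC dphiE]].
have actD x := act_morphD x act_bilin.
pose s : int := (-1) ^+ n.+2.
have homC := homotopy_cochain phiC.
(* Write h for the homotopy. Applied to d phi = ∂ chi it gives ∂ h chi = d h phi + s phi; as s^2 =
   1, phi = d(- s h phi) + ∂(s h chi). *)
exists (fun a => homotopy phi a *~ (- s)); first exact: basic_cochainMz.
exists (fun a => homotopy chi a *~ s); first exact/basic_cochainMz/homotopy_cochain.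
move=> a; rewrite hochschild_dMz // mulrNz opprK.
have dphi b : hochschild_d (@weyl_prod k) act phi b = cochain_partial chi b.
  by rewrite -dphiE subr0.
have := homotopy_differential actD phiC a.
(* The equality of d phi and ∂ chi is pointwise, so [homotopy] is unfolded to rewrite its two values
   and then folded back. *)
rewrite {1}/homotopy !dphi -[X in X = _]/(homotopy (cochain_partial chi) a).
rewrite homotopy_partial !cochain_partialE (morphDMz (mactDr _)) => ->.
move: (hochschild_d _ _ _ _) => y; rewrite mulrzDl addrC; congr (_ + _).
by rewrite -mulrzA -expr2 sqrr_sign mulr1z.
Qed.

Unset Implicit Arguments.
Local Close Scope ring_scope.

Theorem corollary5p5 (k : fieldType) (char0 : [pchar k]%R =i pred0)
    (M : lmodType {poly k}) (act : weyl k -> M -> lpoly M 1)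
    (act_mod : conformal_module (@weyl_prod k) act)
    (fin_M : finite_module M) (n : nat) (n_ge2 : 2 <= n) :
  reduced_cohomology_eq0 (@weyl_prod k) act n.
Proof.
case: n n_ge2 => [|[|n]] // _.
exact: weyl_reduced_cohomology_eq0 act_mod.1.
Qed.
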